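(* Every infinite-dimensional separable Banach space $X$ admits a dense mean Li-Yorke chaotic bounded linear operator $T\colon X\to X$.
   Context: A bounded linear operator $T\colon X\to X$ on a Banach space $X$ is called dense mean Li-Yorke chaotic if there exists a dense uncountable subset $S$ of $X$ such that for every pair $x,y\in S$ of distinct points, $\liminf_{n\to\infty}\frac1n\sum_{i=1}^n\Vert T^ix-T^iy\Vert=0$ and $\limsup_{n\to\infty}\frac1n\sum_{i=1}^n\Vert T^ix-T^iy\Vert>0$. Here $T^i$ denotes the $i$-fold composition of $T$. *)

(* Defs.v *)
From HB Require Import structures.
From mathcomp Require Import all_boot all_order all_algebra.
From mathcomp Require Import all_classical all_reals all_analysis.
From mathcomp Require Import complex.
Import Order.TTheory GRing.Theory Num.Theory.
Import numFieldNormedType.Exports.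

Set Implicit Arguments.
Unset Strict Implicit.
Unset Printing Implicit Defensive.

Local Open Scope classical_set_scope.
Local Open Scope ring_scope.

Definition separable (X : topologicalType) :=
  exists D : set X, countable D /\ dense D.

Definition infinite_dimensional (K : fieldType) (X : lmodType K) :=
  ~ exists (n : nat) (e : 'I_n -> X),
      forall x : X, exists c : 'I_n -> K, x = \sum_(i < n) c i *: e i.

Definition bounded_operator (K : numFieldType) (X : normedModType K)
    (T : X -> X) :=
  exists M : K, forall x : X, `|T x| <= M * `|x|.

(* The norm of a [normedModType K] takes its values in [K].  When [K] is [R[i]]
   these values are nonnegative, hence have zero imaginary part, and [Re `|x|]
   is the usual real norm.  The notions below take the real-valued norm [N] as
   an argument so as to serve both scalar fields. *)
Definition real_norm (R : realType) (X : normedModType R) (x : X) : R := `|x|.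

Definition complex_norm (R : realType) (X : normedModType R[i]) (x : X) : R :=
  complex.Re `|x|.

(* The value at [n = 0] is [0]; it is irrelevant to the limits. *)
Definition mean_orbit_dist (R : realType) (X : zmodType) (N : X -> R)
    (T : X -> X) (x y : X) (n : nat) : R :=
  n%:R^-1 * \sum_(1 <= i < n.+1) N (iter i T x - iter i T y).

Definition mean_li_yorke_pair (R : realType) (X : zmodType) (N : X -> R)
    (T : X -> X) (x y : X) :=
  limn_einf (fun n => (mean_orbit_dist N T x y n)%:E) = 0%E /\
  (0 < limn_esup (fun n => (mean_orbit_dist N T x y n)%:E))%E.

Definition dense_mean_li_yorke_chaotic (R : realType) (K : numFieldType)
    (X : normedModType K) (N : X -> R) (T : X -> X) :=
  exists S : set X,
    [/\ dense S, ~ countable S &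
        forall x y, S x -> S y -> x <> y -> mean_li_yorke_pair N T x y].

(* Main.v *)
Require Import Defs.
From HB Require Import structures.
From mathcomp Require Import all_boot all_order all_algebra.
From mathcomp Require Import all_classical all_reals all_analysis.
From mathcomp Require Import complex.
From mathcomp Require Import ring lra.
(* Hahn-Banach and separability give a biorthogonal system (e_n, f_n) of
   normalized vectors with dense span.  Let T = I + compact be the operator with
   the 2x2 Jordan-like blocks
     T e_2k = (1 - mu_k) e_2k,   T e_2k+1 = (1 - mu_k) e_2k+1 + w_k e_2k,
   where w_k > 0 is small enough for the series defining T to converge and mu_k is
   much smaller than w_k.  Orbits of vectors of the span are summable, since all
   eigenvalues are in [0, 1[; but the orbit of e_2k+1 grows like m w_k up to time
   1 / mu_k, so its means exceed k.  A Baire-type argument gives y whose orbit means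
   have lower limit 0 and do not tend to 0, and {d_t + t y : t in R} is the required
   set, where d_t runs through a dense subset of the span in such a way that each
   value is taken for arbitrarily small t. *)

Set Implicit Arguments.
Unset Strict Implicit.
Unset Printing Implicit Defensive.

Import Order.TTheory GRing.Theory Num.Theory.
Import numFieldNormedType.Exports.

Local Open Scope classical_set_scope.
Local Open Scope ring_scope.

(** * Lower and upper limits of real sequences, and uncountability of the reals *)

Section RealSequences.
Context (R : realType).
Implicit Types u : nat -> R.

Lemma limn_einf_eq0 u : (forall n, 0 <= u n) ->
  (forall e j, 0 < e -> exists2 n, (j <= n)%N & u n <= e) ->
  limn_einf (fun n => (u n)%:E) = 0%E.
Proof.
move=> u0 ue; rewrite limn_einf_lim (cvg_lim (@ereal_hausdorff R) (@cvg_einfs_sup R _)).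
apply/le_anti/andP; split.
  apply/ereal_supP => _ [j _ <-]; apply/lee_addgt0Pr => e e0; rewrite add0e.
  have [n jn un] := ue e j e0.
  by apply: ge_ereal_inf; exists (u n)%:E; [exists n|rewrite lee_fin].
apply: (@le_trans _ _ (einfs (fun n => (u n)%:E) 0)).
  by apply/ereal_infP => _ [n _ <-]; rewrite lee_fin.
by apply: ereal_sup_ubound; exists 0%N.
Qed.

Lemma limn_esup_gt0 u c : 0 < c ->
  (forall j, exists2 n, (j <= n)%N & c <= u n) ->
  (0 < limn_esup (fun n => (u n)%:E))%E.
Proof.
move=> c0 uc; rewrite limn_esup_lim (cvg_lim (@ereal_hausdorff R) (@cvg_esups_inf R _)).
apply: (@lt_le_trans _ _ c%:E); first by rewrite lte_fin.
apply/ereal_infP => _ [j _ <-]; have [n jn un] := uc j.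
apply: (@le_trans _ _ (u n)%:E); first by rewrite lee_fin.
by apply: ereal_sup_ubound; exists n.
Qed.

(** A countable set is Lebesgue null, whereas the unit interval has measure 1. *)
Lemma uncountable_setT : ~ countable [set: R].
Proof.
move=> cR; have : lebesgue_measure (`[0, 1]%classic : set R) = 0%E.
  by apply: countable_lebesgue_measure0; apply: sub_countable cR; exact: subset_card_le.
rewrite lebesgue_measure_itv/= lte_fin ltr01 oppr0 adde0 => /eqP.
by rewrite eqe oner_eq0.
Qed.

End RealSequences.

(** * The Hahn-Banach theorem for real-linear functionals *)

Section HahnBanach.
Context (R : realType) (K : nzRingType) (iota : {rmorphism R -> K}).
Context (V : lmodType K) (p : V -> R).
Hypothesis pD : forall x y, p (x + y) <= p x + p y.
Hypothesis pZ : forall r x, p (iota r *: x) = `|r| * p x.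
Variable v : V.

(* Partial functionals are represented by their graphs, so that Zorn's lemma
   applies to unions; domination by [p] forces a subspace to be a graph.  The
   last clause is vacuous on the empty set, the union of the empty chain. *)
Let dominated (G : set (V * R)) :=
  [/\ forall c z z', G z -> G z' -> G (iota c *: z.1 + z'.1, c * z.2 + z'.2),
      forall z, G z -> z.2 <= p z.1 &
      forall z, G z -> G (v, p v)].

Let p0 : p 0 = 0.
Proof. by rewrite -(scale0r 0) -(rmorph0 iota) pZ normr0 mul0r. Qed.

Let pN x : p (- x) = p x.
Proof. by rewrite -scaleN1r -(rmorphN1 iota) pZ normrN1 mul1r. Qed.

Let p_ge0 x : 0 <= p x.
Proof.
have := pD x (- x); rewrite subrr p0 pN => h; lra.
Qed.

(** Zorn's lemma gives a maximal dominated graph. If it missed [(v, p v)], the last clause of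
    [dominated] would make it empty, and the line [L] through [(v, p v)] would be a larger dominated
    graph. *)
Let max_graph : exists G : set (V * R),
  [/\ dominated G, G (v, p v) & forall B, G `<` B -> ~ dominated B].
Proof.
have [F FP Ftot|G [PG Gmax]] := @Zorn_bigcup _ dominated.
  split=> [c z z' [A FA Az] [B FB Bz']|z [A FA Az]|z [A FA Az]].
  - have [AB|BA] := Ftot _ _ FA FB.
      by exists B => //; have [+ _ _] := FP _ FB; apply => //; exact: AB.
    by exists A => //; have [+ _ _] := FP _ FA; apply => //; exact: BA.
  - by have [_ h _] := FP _ FA; exact: h.
  - by exists A => //; have [_ _ h] := FP _ FA; exact: h Az.
exists G; split => //; apply: contrapT => nGv.
have G0 z : ~ G z by case: PG => _ _ /[apply].
pose L := [set z : V * R | exists t, z = (iota t *: v, t * p v)].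
have Lv : L (v, p v) by exists 1; rewrite rmorph1 scale1r mul1r.
apply: (Gmax L).
  by split => [z /G0//|/(_ _ Lv)/G0].
split => [c _ _ [s ->] [t ->]|_ [t ->]|//] /=.
- by exists (c * s + t); rewrite rmorphD rmorphM scalerDl scalerA mulrDl mulrA.
- by rewrite pZ ler_wpM2r// ler_norm.
Qed.

(** A maximal dominated graph is total, since otherwise it extends to one more vector [w]. Linearity
    is over [R] along [iota], so that complex spaces are covered as real ones. *)
Lemma hahn_banach :
  exists f : V -> R, [/\ forall r x y, f (iota r *: x + y) = r * f x + f y,
    forall x, f x <= p x & f v = p v].
Proof.
have [G [[GL Gp Gv0] Gv Gmax]] := max_graph.
have G00 : G (0, 0).
  have := GL (- 1) _ _ Gv Gv => /=.
  by rewrite rmorphN1 scaleN1r addNr mulN1r addNr.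
have GZ c x r : G (x, r) -> G (iota c *: x, c * r).
  by move=> h; have := GL c _ _ h G00; rewrite /= !addr0.
have GD x r y s : G (x, r) -> G (y, s) -> G (x + y, r + s).
  by move=> h k; have := GL 1 _ _ h k; rewrite /= rmorph1 scale1r mul1r.
have Gfun x r s : G (x, r) -> G (x, s) -> r = s.
  move=> h k; apply/eqP; rewrite eq_le; apply/andP; split.
    have := Gp _ (GL (- 1) _ _ k h); rewrite /= rmorphN1 scaleN1r addNr p0; lra.
  have := Gp _ (GL (- 1) _ _ h k); rewrite /= rmorphN1 scaleN1r addNr p0; lra.
have Gtot w : exists r, G (w, r).
  apply: contrapT => nGw.
  (* The value [c] at [w] has to satisfy [s - p (y - w) <= c <= p (y' + w) - s'] for all [(y, s)]
     and [(y', s')] in [G]. Subadditivity puts every lower bound below every upper bound, so the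
     supremum of the lower bounds will do. *)
  pose A := [set z.2 - p (z.1 - w) | z in G].
  have ubA z' : G z' -> ubound A (p (z'.1 + w) - z'.2).
    case: z' => y' s' Gz' _ [[y s] Gz <-] /=.
    have := Gp _ (GD _ _ _ _ Gz Gz') => /=.
    have := pD (y - w) (y' + w); rewrite addrACA addNr addr0; lra.
  have supA : has_sup A.
    split; first by exists (0 - p (0 - w)), (0, 0).
    by exists (p (0 + w) - 0); exact: ubA G00.
  pose c := sup A.
  have cl y s : G (y, s) -> s - p (y - w) <= c.
    by move=> Gz; apply: ub_le_sup; [case: supA|exists (y, s)].
  have cu y s : G (y, s) -> c <= p (y + w) - s.
    by move=> Gz; apply: ge_sup; [case: supA|exact: ubA Gz].
  pose B := [set z : V * R | exists y s t, G (y, s) /\ z = (y + iota t *: w, s + t * c)].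
  apply: (Gmax B).
    split => [[y s] Gz|/(_ (w, c)) GB].
      by exists y, s, 0; rewrite rmorph0 scale0r mul0r !addr0.
    apply: nGw; exists c; apply: GB.
    by exists 0, 0, 1; rewrite rmorph1 scale1r mul1r !add0r.
  split=> [a _ _ [y [s [t [Gz ->]]]] [y' [s' [t' [Gz' ->]]]]||_ _].
  - exists (iota a *: y + y'), (a * s + s'), (a * t + t').
    split; first exact: (GL a _ _ Gz Gz').
    congr (_, _) => /=; last by ring.
    by rewrite scalerDr rmorphD rmorphM scalerDl scalerA addrACA.
  - move=> _ [y [s [t [Gz ->]]]] /=.
    (* Dividing by [|t|] reduces domination at [y + iota t *: w] to the two bounds on [c], the upper
       one for [t > 0] and the lower one for [t < 0]. *)
    have [t0|t0|->] := ltrgt0P t.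
    + have := cu _ _ (GZ t^-1 _ _ Gz).
      have -> : iota t^-1 *: y + w = iota t^-1 *: (y + iota t *: w).
        by rewrite scalerDr scalerA -rmorphM mulVf ?rmorph1 ?scale1r// gt_eqF.
      rewrite pZ gtr0_norm ?invr_gt0// -mulrBr mulrC ler_pdivlMr//; lra.
    + have u0 : 0 < - t by rewrite oppr_gt0.
      have := cl _ _ (GZ (- t)^-1 _ _ Gz).
      have -> : iota (- t)^-1 *: y - w = iota (- t)^-1 *: (y + iota t *: w).
        rewrite scalerDr scalerA -rmorphM invrN mulNr.
        by rewrite mulVf ?rmorphN1 ?scaleN1r// lt_eqF.
      rewrite pZ gtr0_norm ?invr_gt0// -mulrBr mulrC ler_pdivrMr//; lra.
    + by rewrite rmorph0 scale0r mul0r !addr0; exact: Gp Gz.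
  - by exists v, (p v), 0; rewrite rmorph0 scale0r mul0r !addr0.
have [f fG] := choice Gtot.
exists f; split.
- by move=> a x y; apply: Gfun (fG _) _; exact: (GL a _ _ (fG x) (fG y)).
- by move=> x; exact: Gp (fG x).
- exact: Gfun (fG v) Gv.
Qed.

End HahnBanach.

(** * The real-valued norm, treated for both scalar fields at once *)

Section RealValuedNorm.
(* [K] stands for [R] or [R[i]]: [iota] is the embedding of [R] in [K] and [re] its
   inverse on nonnegative elements, so that [re `|x|] is the real-valued norm. *)
Context (R : realType) (K : numFieldType) (iota : {rmorphism R -> K}).
Variable re : K -> R.
Hypothesis iota_le : forall x y, (iota x <= iota y) = (x <= y).
Hypothesis reK : forall z, 0 <= z -> iota (re z) = z.

Local Notation nm x := (re `|x|).

Let iota_inj : injective iota.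
Proof. by move=> x y xy; apply: le_anti; rewrite -!iota_le xy lexx. Qed.

Let iota_lt x y : (iota x < iota y) = (x < y).
Proof. by rewrite !lt_neqAle iota_le (inj_eq iota_inj). Qed.

Section NormedZmodule.
Context (X : normedZmodType K).
Implicit Types x y : X.

Lemma nm_ge0 x : 0 <= nm x.
Proof. by rewrite -iota_le rmorph0 reK. Qed.

Lemma nm0 : nm (0 : X) = 0.
Proof. by apply: iota_inj; rewrite rmorph0 reK// normr0. Qed.

Lemma nm0_eq0 x : nm x = 0 -> x = 0.
Proof. by move=> x0; apply/eqP; rewrite -normr_eq0 -[`|x|]reK// x0 rmorph0. Qed.

Lemma nm_gt0 x : x <> 0 -> 0 < nm x.
Proof.
move=> x0; rewrite lt_neqAle nm_ge0 andbT; apply/eqP => h.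
by apply: x0; exact: nm0_eq0.
Qed.

Lemma nmN x : nm (- x) = nm x.
Proof. by rewrite normrN. Qed.

Lemma nmBC x y : nm (x - y) = nm (y - x).
Proof. by rewrite distrC. Qed.

Lemma nmD x y : nm (x + y) <= nm x + nm y.
Proof. by rewrite -iota_le rmorphD !reK// ler_normD. Qed.

Lemma nmB x y : nm x - nm y <= nm (x + y).
Proof. by have := nmD (x + y) (- y); rewrite addrK nmN; lra. Qed.

End NormedZmodule.

Lemma nmM (c d : K) : nm (c * d) = nm c * nm d.
Proof. by apply: iota_inj; rewrite rmorphM !reK// normrM. Qed.

Lemma nm_iota r : nm (iota r) = `|r|.
Proof.
apply: iota_inj; rewrite reK//.
have [r0|r0] := leP 0 r.
  by rewrite (ger0_norm r0) ger0_norm// -(rmorph0 iota) iota_le.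
rewrite (ltr0_norm r0) rmorphN ltr0_norm//.
by rewrite -(rmorph0 iota) iota_lt.
Qed.

Lemma nmZ (X : normedModType K) c (x : X) : nm (c *: x) = nm c * nm x.
Proof. by apply: iota_inj; rewrite rmorphM !reK// normrZ. Qed.

Lemma nmZr (X : normedModType K) r (x : X) : nm (iota r *: x) = `|r| * nm x.
Proof. by rewrite nmZ nm_iota. Qed.


(** * Geometric convergence and series of operators *)

Lemma le_geometric_le0 (r C : R) : (forall n, r <= C * 2^-1 ^+ n) -> r <= 0.
Proof.
move=> h; rewrite leNgt; apply/negP => r0.
have C0 : 0 < C by have := h 0%N; rewrite expr0; lra.
pose n := (Num.truncn (C / r)).+1.
have := h n; rewrite exprVn ler_pdivlMr ?exprn_gt0//.
apply/negP; rewrite -ltNge mulrC -ltr_pdivrMr//.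
apply: (lt_le_trans (truncnS_gt _)).
by rewrite -natrX ler_nat ltnW// ltn_expl.
Qed.

Section Complete.
Context (X : completeNormedModType K).

Lemma geometric_cvg (u : nat -> X) (B : R) :
  (forall n, nm (u n.+1 - u n) <= B * 2^-1 ^+ n) ->
  exists l, forall n, nm (u n - l) <= 2 * B * 2^-1 ^+ n.
Proof.
move=> uB.
have B0 : 0 <= B by have := uB 0%N; rewrite expr0 mulr1; apply: (le_trans (nm_ge0 _)).
have h0 n : 0 <= 2^-1 ^+ n :> R by rewrite exprn_ge0.
(* The factor [1 - 2^-1 ^+ k] comes from the partial sums of the geometric series and lets the
   induction on [k] close. *)
have uk n k : nm (u (n + k)%N - u n) <= 2 * B * 2^-1 ^+ n * (1 - 2^-1 ^+ k).
  elim: k => [|k IH]; first by rewrite addn0 subrr nm0 expr0 subrr mulr0.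
  have := nmD (u (n + k.+1)%N - u (n + k)%N) (u (n + k)%N - u n).
  rewrite subrKA addnS => /le_trans; apply.
  have := lerD (uB (n + k)%N) IH => /le_trans; apply.
  by rewrite exprD exprS; lra.
have uc n m : (n <= m)%N -> nm (u m - u n) <= 2 * B * 2^-1 ^+ n.
  move=> /subnKC <-; apply: (le_trans (uk _ _)).
  by rewrite ler_piMr// ?mulr_ge0// lerBlDr lerDl.
have : cvg (u @ \oo).
  apply: cauchy_cvg; apply: cauchy_exP => e e0.
  have re0 : 0 < re e. by rewrite -iota_lt rmorph0 reK// ltW.
  have [n hn] : exists n, 2 * B * 2^-1 ^+ n < re e.
    apply: contrapT => /forallNP h.
    have := @le_geometric_le0 (re e) (2 * B).
    rewrite leNgt re0 => G; apply: notF; apply: G => n.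
    by rewrite leNgt; apply/negP; exact: h.
  exists (u n), n => //= m nlem.
  rewrite -ball_normE /ball_ /= distrC -[ltLHS]reK// -[ltRHS](reK (ltW e0)).
  by rewrite iota_lt; have := uc _ _ nlem; lra.
move=> /cvg_ex[l ul]; exists l => n.
apply/ler_addgt0Pr => e e0.
have ie0 : 0 < iota e.
  by rewrite -(rmorph0 iota) iota_lt.
move/cvgrPdist_le : ul => /(_ _ ie0)[m _ /(_ (maxn m n))] /=.
rewrite leq_maxl => /(_ isT); rewrite -[leLHS]reK// iota_le nmBC => h.
have := nmD (u n - u (maxn m n)) (u (maxn m n) - l); rewrite subrKA => /le_trans; apply.
by apply: lerD => //; rewrite nmBC uc// leq_maxr.
Qed.

(** The partial sums converge at the rate [2^-1 ^+ n]. The last clause evaluates the sum at vectors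
    killed by all terms but one, as the basis vectors of the Jordan blocks will be. *)
Lemma operator_series (u : nat -> X -> X) :
  (forall k, linear (u k)) ->
  (forall k x, nm (u k x) <= 2^-1 ^+ k * nm x) ->
  exists S : {linear X -> X}, (forall x, nm (S x) <= 2 * nm x) /\
    forall x j, (forall k, k != j -> u k x = 0) -> S x = u j x.
Proof.
move=> ul ub; pose s x n := \sum_(k < n) u k x.
have /choice[S Ss] x : exists l, forall n, nm (s x n - l) <= 2 * nm x * 2^-1 ^+ n.
  apply: geometric_cvg => n; rewrite /s big_ord_recr/= addrAC subrr add0r.
  by rewrite mulrC.
have sl n a x y : s (a *: x + y) n = a *: s x n + s y n.
  rewrite /s scaler_sumr -big_split; apply: eq_bigr => k _; exact: ul.
have Sl : linear S.
  move=> a x y; apply/eqP; rewrite -subr_eq0; apply/eqP/nm0_eq0/le_anti.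
  rewrite nm_ge0 andbT.
  (* The partial sums are linear, and each of the three limits is within a constant times
     [2^-1 ^+ n] of its partial sum; hence so small is the defect of linearity of [S]. *)
  apply: (@le_geometric_le0 _ (2 * nm (a *: x + y) + nm a * (2 * nm x) + 2 * nm y)) => n.
  have -> : S (a *: x + y) - (a *: S x + S y) =
      - (s (a *: x + y) n - S (a *: x + y)) + (a *: (s x n - S x) + (s y n - S y)).
    by rewrite sl opprB scalerBr (addrACA (a *: s x n)) -opprD subrKA.
  apply: (le_trans (nmD _ _)); rewrite nmN 2!mulrDl -addrA; apply: lerD => //.
  apply: (le_trans (nmD _ _)); apply: lerD => //.
  by rewrite nmZ -mulrA ler_wpM2l// nm_ge0.
pose SL := GRing.isLinear.Build K X X _ S Sl.
pose T : {linear X -> X} := HB.pack S SL.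
exists T; split => [x|x j uj0] /=.
  by have := Ss x 0%N; rewrite /s big_ord0 sub0r nmN expr0 mulr1.
apply/eqP; rewrite -subr_eq0; apply/eqP/nm0_eq0/le_anti; rewrite nm_ge0 andbT.
apply: (@le_geometric_le0 _ (2 * nm x)) => n.
have jn : (j < n + j.+1)%N by rewrite ltn_addl.
have := Ss x (n + j.+1)%N; rewrite nmBC /s (bigD1 (Ordinal jn))//= big1 => [|k kj].
  rewrite addr0 => /le_trans; apply; rewrite ler_wpM2l ?mulr_ge0 ?nm_ge0//.
  by rewrite ler_wiXn2l ?leq_addr// invf_le1 ?ler1n.
by apply: uj0; apply: contra kj => /eqP kj; apply/eqP/val_inj.
Qed.

End Complete.

(** * Biorthogonal systems, from functionals that separate points *)

Section Biorthogonal.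
Context (X : normedModType K).

Definition bounded_by_nm (Y : normedZmodType K) (f : X -> Y) :=
  exists B, 0 <= B /\ forall x, nm (f x) <= B * nm x.

Hypothesis separating : forall v : X, v <> 0 -> exists phi : X -> K,
  [/\ scalar phi, bounded_by_nm phi & phi v = 1].

(* One Gram-Schmidt step: [P] is a projection onto the span of the vectors found
   so far, and [P + f (_) *: e] projects onto a span that also contains [y]. *)
Let step (P : X -> X) (y : X) : linear P -> bounded_by_nm P ->
    (forall x, P (P x) = P x) -> (exists x, P x <> x) ->
  exists ef : X * (X -> K), let: (e, f) := ef in
  [/\ nm e = 1, P e = 0, (scalar f /\ bounded_by_nm f),
      (forall x, f (P x) = 0) & f e = 1 /\ y = P y + f y *: e].
Proof.
move=> Pl [C [C0 PC]] PP [x0 Px0].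
(* If [P] already fixes [y], any vector that [P] moves supplies the new direction. *)
have [v [Pv vy]] : exists v, P v <> v /\ (v = y \/ P y = y).
  by have [Py|Py] := pselect (P y = y); [exists x0|exists y]; auto.
pose u := v - P v.
have u0 : u <> 0 by move=> /eqP; rewrite subr_eq0 => /eqP /esym.
have nu := nm_gt0 u0.
have P0 : P 0 = 0 by have := Pl (-1) 0 0; rewrite scaleN1r oppr0 addr0 scaleN1r addNr.
have PB x z : P (x - z) = P x - P z.
  by rewrite -scaleN1r addrC Pl scaleN1r addrC.
have PZ c x : P (c *: x) = c *: P x by have := Pl c x 0; rewrite P0 !addr0.
pose e := iota (nm u)^-1 *: u.
have ne : nm e = 1 by rewrite nmZr gtr0_norm ?invr_gt0// mulVf// gt_eqF.
have e0 : e <> 0 by move=> e0; move: ne; rewrite e0 nm0 => /eqP; rewrite eq_sym oner_eq0.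
have Pe : P e = 0 by rewrite PZ PB PP subrr scaler0.
have [phi [phil [B [B0 phiB]] phie]] := separating e0.
have phi0 : phi 0 = 0 by have := phil (-1) 0 0; rewrite scaleN1r oppr0 addr0 mulN1r addNr.
(* Composing [phi] with [x - P x] makes it vanish on the range of [P] and keeps its value at [e],
   because [P e = 0]. *)
exists (e, fun x => phi (x - P x)); split => //.
- split=> [a x z|].
    have -> : a *: x + z - P (a *: x + z) = a *: (x - P x) + (z - P z).
      by rewrite Pl scalerBr addrACA opprD.
    exact: phil.
  exists (B * (1 + C)); split=> [|x]; first by rewrite mulr_ge0// addr_ge0.
  apply: (le_trans (phiB _)); rewrite -mulrA ler_wpM2l//.
  by have := nmD x (- P x); rewrite nmN; have := PC x; lra.
- by move=> x; rewrite PP subrr phi0.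
split; first by rewrite Pe subr0.
case: vy => [vy|->]; last by rewrite subrr phi0 scale0r addr0.
have uE : u = iota (nm u) *: e.
  by rewrite scalerA -rmorphM divff ?rmorph1 ?scale1r// gt_eqF.
have -> : phi (y - P y) = iota (nm u).
  rewrite -vy -/u {1}uE.
  by have := phil (iota (nm u)) e 0; rewrite phie phi0 !addr0 mulr1.
by rewrite -uE /u vy subrKC.
Qed.

(** The Gram-Schmidt step is iterated from the zero projection, with [d n] as the vector to be
    captured at step [n]. *)
Lemma biorthogonal_system (d : nat -> X) : infinite_dimensional X ->
  exists (e : nat -> X) (f : nat -> X -> K),
  [/\ forall n, scalar (f n), forall n, bounded_by_nm (f n),
      forall n, nm (e n) = 1, forall i j, f i (e j) = (i == j)%:R &
      forall n, d n = \sum_(j < n.+1) f j (d n) *: e j].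
Proof.
move=> Xinf.
(* The conditions on the projection stand inside the existential, so that choice yields a step
   function defined on all pairs; where they fail, its value is the default [(0, fun=> 0)]. *)
have /choice[g gP] (Py : (X -> X) * X) : exists ef : X * (X -> K),
    linear Py.1 -> bounded_by_nm Py.1 ->
    (forall x, Py.1 (Py.1 x) = Py.1 x) -> (exists x, Py.1 x <> x) ->
    let: (e, f) := ef in
    [/\ nm e = 1, Py.1 e = 0, (scalar f /\ bounded_by_nm f),
      (forall x, f (Py.1 x) = 0) & f e = 1 /\ Py.2 = Py.1 Py.2 + f Py.2 *: e].
  case: Py => P y /=.
  have [[h1 h2 h3 h4]|h] := pselect [/\ linear P, bounded_by_nm P,
      forall x, P (P x) = P x & exists x, P x <> x].
    by have [ef efP] := step y h1 h2 h3 h4; exists ef.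
  by exists (0, fun=> 0) => h1 h2 h3 h4; exfalso; apply: h.
pose P := fix P n := if n is m.+1 then
  fun x => P m x + (g (P m, d m)).2 x *: (g (P m, d m)).1 else fun=> 0.
pose e n := (g (P n, d n)).1; pose f n := (g (P n, d n)).2.
have PE n x : P n x = \sum_(j < n) f j x *: e j.
  by elim: n => [|n IH]; rewrite ?big_ord0// big_ord_recr/= -IH.
(* If [P n] were the identity, the first [n] vectors would span the space. *)
have Pne n : exists x, P n x <> x.
  apply: contrapT => /forallNP Pn; apply: Xinf; exists n, (fun j => e j) => x.
  exists (fun j => f j x); rewrite -PE; apply/esym.
  by apply: contrapT; exact: Pn.
have good n : [/\ linear (P n), bounded_by_nm (P n) & forall x, P n (P n x) = P n x].
  elim: n => [|n [Pl Pb PP]] /=.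
    split=> [a x y|| //]; first by rewrite scaler0 addr0.
    by exists 0; split=> // x; rewrite nm0 mul0r.
  have := gP (P n, d n) Pl Pb PP (Pne n); rewrite -/(e n) -/(f n) /=.
  have [C [C0 PC]] := Pb.
  case gE : (g _) => [en fn]; rewrite /f /e gE /=.
  move=> [ne Pe [fl [B [B0 fB]]] fP [fe _]]; split.
  - move=> a x y; rewrite Pl fl scalerDl scalerDr -scalerA -!addrA.
    by congr (_ + _); rewrite addrCA.
  - exists (C + B); split=> [|x]; first exact: addr_ge0.
    apply: (le_trans (nmD _ _)); rewrite nmZ ne mulr1 mulrDl.
    by rewrite lerD.
  - move=> x; set c := fn x.
    have -> : P n (P n x + c *: en) = P n x.
      by rewrite addrC Pl Pe scaler0 add0r PP.
    have -> // : fn (P n x + c *: en) = c.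
    by rewrite addrC fl fP addr0 fe mulr1.
have main n : [/\ nm (e n) = 1, P n (e n) = 0, (scalar (f n) /\ bounded_by_nm (f n)),
      (forall x, f n (P n x) = 0) & f n (e n) = 1 /\ d n = P n (d n) + f n (d n) *: e n].
  have [Pl Pb PP] := good n.
  by have := gP (P n, d n) Pl Pb PP (Pne n); rewrite /e /f; case: (g _).
have fl n : scalar (f n) by have [_ _ []] := main n.
have f0 n : f n 0 = 0.
  by have := fl n (-1) 0 0; rewrite scaleN1r oppr0 addr0 mulN1r addNr.
(* With [P n (e n) = 0] and [f n (P n x) = 0], these two invariants give both off-diagonal cases of
   biorthogonality. *)
have inv n i : (i < n)%N -> P n (e i) = e i /\ forall x, f i (P n x) = f i x.
  elim: n => // n IH; rewrite ltnS leq_eqVlt => /predU1P[->|/IH[Pe fP]].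
    have [_ Pe _ fP [fe _]] := main n; split=> [|x] /=.
      by rewrite Pe add0r -/(f n) -/(e n) fe scale1r.
    by rewrite -/(f n) -/(e n) addrC fl fe fP addr0 mulr1.
  have [_ Pn _ fPn _] := main n; split=> [|x] /=; rewrite -/(f n) -/(e n).
    by rewrite -Pe fPn scale0r addr0 !Pe.
  by rewrite addrC fl -(fP (e n)) Pn f0 mulr0 add0r fP.
exists e, f; split => //.
- by move=> n; have [_ _ []] := main n.
- by move=> n; have [] := main n.
- move=> i j; have [ij|ji|->] := ltngtP i j.
  + by have [_ <-] := inv _ _ ij; have [_ -> _ _ _] := main j; rewrite f0.
  + by have [<- _] := inv _ _ ji; have [_ _ _ -> _] := main i.
  + by have [_ _ _ _ []] := main j.
- by move=> n; have [_ _ _ _ [_ dE]] := main n; rewrite -PE.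
Qed.

End Biorthogonal.

(** * Means of norms along orbits, and the Baire-type argument *)

Section OrbitMeans.
Context (X : completeNormedModType K).

(** Baire category in constructive form: the closed balls chosen in turn are nested with radii
    tending to 0, and [Q j] holds on the whole of ball [j.+1], hence at the limit of the centres. *)
Lemma nested_balls (Q : nat -> X -> Prop) :
  (forall j x r, 0 < r -> exists x' r', [/\ 0 < r', r' <= r / 2,
      nm (x' - x) <= r / 2 & forall z, nm (z - x') <= r' -> Q j z]) ->
  exists y, forall j, Q j y.
Proof.
move=> QP.
have /choice[g gP] (s : nat * (X * R)) : exists s' : X * R, 0 < s.2.2 ->
    [/\ 0 < s'.2, s'.2 <= s.2.2 / 2, nm (s'.1 - s.2.1) <= s.2.2 / 2 &
        forall z, nm (z - s'.1) <= s'.2 -> Q s.1 z].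
  case: s => j [x r] /=; have [r0|r0] := ltP 0 r; last by exists (x, r).
  by have [x' [r' h]] := QP j x r r0; exists (x', r').
pose s := fix s n := if n is m.+1 then g (m, s m) else (0, 1).
have s0 n : 0 < (s n).2 by elim: n => [|n IH] //=; have [] := gP (n, s n) IH.
have sS n := gP (n, s n) (s0 n).
have s2 n : (s n).2 <= 2^-1 ^+ n.
  elim: n => [|n IH]; first by rewrite expr0.
  by have [_ + _ _] := sS n; rewrite exprS /=; lra.
have [l lP] : exists l, forall n, nm ((s n).1 - l) <= 2 * 1 * 2^-1 ^+ n.
  apply: geometric_cvg => n; have [_ _ /= + _] := sS n; rewrite mul1r => /le_trans; apply.
  by have := s2 n; have := s0 n; lra.
exists l => j; have [_ _ _ /= QS] := sS j; apply: QS.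
rewrite -/(s j.+1); move: (j.+1) => {}j.
(* Distance of centres plus the later radius is at most the earlier radius, so the balls are nested;
   letting [k] grow puts [l] in ball [j]. *)
have sk k : nm ((s (j + k)%N).1 - (s j).1) <= (s j).2 - (s (j + k)%N).2.
  elim: k => [|k IH]; first by rewrite addn0 !subrr nm0.
  have := nmD ((s (j + k.+1)%N).1 - (s (j + k)%N).1) ((s (j + k)%N).1 - (s j).1).
  rewrite subrKA addnS; have [_ /= h1 h2 _] := sS (j + k)%N; lra.
rewrite -subr_le0; apply: (@le_geometric_le0 _ 2) => k.
have := nmD (l - (s (j + k)%N).1) ((s (j + k)%N).1 - (s j).1);
rewrite subrKA (nmBC l (s (j + k)%N).1).
have := sk k; have := s0 (j + k)%N; have := lP (j + k)%N.
rewrite mulr1 exprD => h1 h2 h3 h4.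
have : 2 * (2^-1 ^+ j * 2^-1 ^+ k) <= 2 * 2^-1 ^+ k :> R.
  by rewrite ler_wpM2l// ler_piMl ?exprn_ge0// exprn_ile1 ?invf_le1 ?ler1n.
lra.
Qed.

Variable T : {linear X -> X}.
Implicit Types (x y h : X).

Lemma iter_linear n : linear (iter n T).
Proof. by elim: n => [|n IH] a x y //=; rewrite IH linearP. Qed.

Let iterD n x y : iter n T (x + y) = iter n T x + iter n T y.
Proof. by have := iter_linear n 1 x y; rewrite !scale1r. Qed.

Let iter0 n : iter n T 0 = 0.
Proof. by elim: n => [|n IH] //=; rewrite IH linear0. Qed.

Let iterZ n c x : iter n T (c *: x) = c *: iter n T x.
Proof. by have := iter_linear n c x 0; rewrite iter0 !addr0. Qed.

Let iterN n x : iter n T (- x) = - iter n T x.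
Proof. by rewrite -scaleN1r iterZ scaleN1r. Qed.

Definition orbit_mean n x := n%:R^-1 * \sum_(1 <= i < n.+1) nm (iter i T x).

Definition summable_orbit x := exists C, forall n, \sum_(0 <= i < n) nm (iter i T x) <= C.

Lemma mean_orbit_distE x y n :
  mean_orbit_dist (fun x => nm x) T x y n = orbit_mean n (x - y).
Proof.
by rewrite /mean_orbit_dist; under eq_bigr do rewrite -iterN -iterD.
Qed.

Lemma orbit_mean_ge0 n x : 0 <= orbit_mean n x.
Proof. by rewrite mulr_ge0 ?invr_ge0 ?ler0n// sumr_ge0// => i _; exact: nm_ge0. Qed.

Lemma orbit_meanD n x y : orbit_mean n (x + y) <= orbit_mean n x + orbit_mean n y.
Proof.
rewrite -mulrDr ler_wpM2l ?invr_ge0 ?ler0n// -big_split ler_sum// => i _.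
by rewrite iterD nmD.
Qed.

Lemma orbit_meanN n x : orbit_mean n (- x) = orbit_mean n x.
Proof. by congr (_ * _); apply: eq_bigr => i _; rewrite iterN nmN. Qed.

Lemma orbit_meanZ n r x : orbit_mean n (iota r *: x) = `|r| * orbit_mean n x.
Proof.
rewrite mulrCA mulr_sumr; congr (_ * _); apply: eq_bigr => i _.
by rewrite iterZ nmZr.
Qed.

(** A crude bound, but it gives continuity of the [n]-th mean at 0, which is what the choice of
    radii requires. *)
Lemma orbit_mean_le M n x : 1 <= M -> (forall x, nm (T x) <= M * nm x) ->
  orbit_mean n x <= M ^+ n * nm x.
Proof.
move=> M1 TM; have M0 : 0 <= M by lra.
have iM i : nm (iter i T x) <= M ^+ i * nm x.
  elim: i => [|i IH] /=; first by rewrite expr0 mul1r.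
  by apply: (le_trans (TM _)); rewrite exprS -mulrA ler_wpM2l.
have [->|n0] := posnP n.
  by rewrite /orbit_mean invr0 mul0r expr0 mul1r nm_ge0.
rewrite /orbit_mean ler_pdivrMl ?ltr0n//.
have : \sum_(1 <= i < n.+1) nm (iter i T x) <= \sum_(1 <= i < n.+1) M ^+ n * nm x.
  rewrite big_nat_cond [leRHS]big_nat_cond ler_sum// => i /andP[/andP[_ iltn] _].
  by apply: (le_trans (iM _)); rewrite ler_wpM2r ?nm_ge0// ler_weXn2l.
by rewrite sumr_const_nat subSS subn0 mulr_natl.
Qed.

Lemma summable_orbitD x y :
  summable_orbit x -> summable_orbit y -> summable_orbit (x + y).
Proof.
move=> [C xC] [D yD]; exists (C + D) => n; apply: le_trans (lerD (xC n) (yD n)).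
by rewrite -big_split ler_sum// => i _; rewrite iterD nmD.
Qed.

Lemma summable_orbitZ c x : summable_orbit x -> summable_orbit (c *: x).
Proof.
move=> [C xC]; exists (nm c * C) => n.
under eq_bigr do rewrite iterZ nmZ.
by rewrite -mulr_sumr ler_wpM2l ?nm_ge0.
Qed.

Lemma summable_orbitN x : summable_orbit x -> summable_orbit (- x).
Proof. by rewrite -scaleN1r; exact: summable_orbitZ. Qed.

Lemma summable_orbit0 : summable_orbit 0.
Proof. by exists 0 => n; rewrite big1// => i _; rewrite iter0 nm0. Qed.

(** Summing [nm (T (iter i T h)) <= lambda * nm (iter i T h) + nm (iter i T u)] bounds [1 - lambda]
    times the orbit sum of [h] by [nm h + C]. It serves both vectors of a Jordan block. *)
Lemma summable_orbit_contraction (lambda : R) h u : 0 <= lambda -> lambda < 1 ->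
  T h = iota lambda *: h + u -> summable_orbit u -> summable_orbit h.
Proof.
move=> l0 l1 Th [C uC]; exists ((nm h + C) / (1 - lambda)).
have C0 : 0 <= C by have := uC 0%N; rewrite big_nil.
have l10 : 0 < 1 - lambda by lra.
elim=> [|n IH].
  by rewrite big_nil; apply: divr_ge0; [exact: addr_ge0 (nm_ge0 _) C0|exact: ltW].
rewrite big_nat_recl//= .
have : \sum_(0 <= i < n) nm (T (iter i T h)) <=
    lambda * \sum_(0 <= i < n) nm (iter i T h) + \sum_(0 <= i < n) nm (iter i T u).
  rewrite mulr_sumr -big_split ler_sum// => i _ /=.
  rewrite -iterS iterSr Th iterD iterZ; apply: (le_trans (nmD _ _)).
  by rewrite nmZr ger0_norm.
have := uC n; have := ler_wpM2l l0 IH.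
have : lambda * ((nm h + C) / (1 - lambda)) = (nm h + C) / (1 - lambda) - (nm h + C).
  by field; lra.
lra.
Qed.

Lemma summable_orbit_mean x e : summable_orbit x -> 0 < e ->
  exists m, forall n, (m <= n)%N -> orbit_mean n x <= e.
Proof.
move=> [C xC] e0; exists (Num.truncn (C / e)).+1 => n mn.
have C0 : 0 <= C by have := xC 0%N; rewrite big_nil.
have n0 : 0 < n%:R :> R by rewrite ltr0n (leq_trans _ mn).
rewrite ler_pdivrMl//.
have := xC n.+1; rewrite big_ltn//= => h.
have : C / e <= n%:R.
  by apply: (le_trans (ltW (truncnS_gt _))); rewrite ler_nat.
rewrite ler_pdivrMr// => h2; have := nm_ge0 x; lra.
Qed.

(** Near any [x] lies [x' = h + p] with [p] summable and [h] small but of large mean at some time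
    [n]. As [x'] is summable too, its means become small at a later time. Both effects persist on a
    small ball around [x']. *)
Lemma irregular_vector (M : R) :
  (forall x, nm (T x) <= M * nm x) ->
  (forall x e, 0 < e -> exists p, summable_orbit p /\ nm (p - x) <= e) ->
  (forall j e, 0 < e -> exists h n,
    [/\ summable_orbit h, nm h <= e, (j <= n)%N & 3 <= orbit_mean n h]) ->
  exists y, forall j,
    (exists2 n, (j <= n)%N & orbit_mean n y <= j.+1%:R^-1) /\
    (exists2 n, (j <= n)%N & 1 <= orbit_mean n y).
Proof.
move=> TM0 approx growth; pose N := Num.max M 1.
have N1 : 1 <= N by rewrite le_max lexx orbT.
have TN x : nm (T x) <= N * nm x.
  by apply: (le_trans (TM0 _)); rewrite ler_wpM2r ?nm_ge0// le_max lexx.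
have NX n : 0 < N ^+ n by rewrite exprn_gt0//; lra.
apply: nested_balls => j x r r0.
have r4 : 0 < r / 4 by lra.
have [p [sp px]] := approx x _ r4.
have [m pm] := summable_orbit_mean sp ltr01.
have [h [n [sh hr jn Ln]]] := growth (maxn j m) _ r4.
pose x' := h + p.
have d0 : 0 < j.+1%:R^-1 / 2 :> R by rewrite divr_gt0.
have [m' xm'] := summable_orbit_mean (summable_orbitD sh sp) d0.
pose n' := maxn j m'.
(* The last two radii keep the means of [z - x'] at most 1 at time [n] and at most half of
   [j.+1%:R^-1] at time [n']. At time [n], the mean 3 of [h] then loses at most 1 to [p] and 1 to
   [z - x']. *)
exists x', (Num.min (r / 2) (Num.min (N ^+ n)^-1 (j.+1%:R^-1 / 2 / N ^+ n'))).
split.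
- by rewrite !lt_min invr_gt0 NX (divr_gt0 d0 (NX _)) !andbT; lra.
- by rewrite ge_min lexx.
- by have := nmD h (p - x); rewrite addrA; lra.
move=> z; rewrite !le_min => /and3P[_ zn zn'].
have Lz k c : nm (z - x') <= c / N ^+ k -> orbit_mean k (z - x') <= c.
  by rewrite ler_pdivlMr// mulrC; apply: le_trans; exact: orbit_mean_le.
split.
  exists n'; first exact: leq_maxl.
  have := xm' n' (leq_maxr _ _); have := Lz _ _ zn'; rewrite -/x'.
  by have := orbit_meanD n' (z - x') x'; rewrite subrK; move: (j.+1%:R^-1) => v; lra.
exists n; first by rewrite (leq_trans _ jn)// leq_maxl.
have := pm n; rewrite (leq_trans (leq_maxr _ _) jn) => /(_ isT).
have := Lz n 1; rewrite mul1r => /(_ zn).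
have := orbit_meanD n (x' - z) z; rewrite subrK -(orbit_meanN n (x' - z)) opprB.
have := orbit_meanD n x' (- p); rewrite {1}/x' addrK orbit_meanN; lra.
Qed.

End OrbitMeans.

(** * Jordan blocks: growth along orbits, and the operator built from them *)

Section JordanBlocks.
Context (X : completeNormedModType K).
Implicit Types (T : {linear X -> X}).

Lemma jordan_iter T (lambda w : R) g h i :
  T g = iota lambda *: g -> T h = iota lambda *: h + iota w *: g ->
  iter i.+1 T h =
    iota (lambda ^+ i.+1) *: h + iota (i.+1%:R * lambda ^+ i * w) *: g.
Proof.
move=> Tg Th; elim: i => [|i IH]; first by rewrite /= Th expr1 expr0 !mul1r.
rewrite iterS IH linearD !linearZ Th Tg /= scalerDr !scalerA -!rmorphM -addrA.
rewrite -scalerDl -rmorphD; congr (iota _ *: _ + iota _ *: _).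
  by rewrite [RHS]exprSr.
by rewrite -[i.+2]addn1 natrD !exprS; ring.
Qed.

(** While [mu * n%:R <= 2^-1], Bernoulli's inequality keeps [(1 - mu) ^+ i] above one half. So the
    [g]-component of [iter i.+1 T h] has norm at least [i.+1%:R * w / 2] and the [h]-component at
    most 1. *)
Lemma jordan_growth T (mu w : R) g h n :
  nm g = 1 -> nm h = 1 -> 0 <= mu <= 1 -> 0 <= w -> (0 < n)%N ->
  mu * n%:R <= 2^-1 ->
  T g = iota (1 - mu) *: g -> T h = iota (1 - mu) *: h + iota w *: g ->
  w * n.+1%:R / 4 - 1 <= orbit_mean T n h.
Proof.
move=> ng nh /andP[mu0 mu1] w0 n0 mun Tg Th.
have bernoulli i : 1 - mu * i%:R <= (1 - mu) ^+ i.
  elim: i => [|i IH]; first by rewrite expr0 mulr0 subr0.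
  have l0 : 0 <= 1 - mu by lra.
  have := ler_wpM2l l0 IH; rewrite exprS -natr1.
  have : 0 <= mu * mu * i%:R by rewrite !mulr_ge0.
  lra.
have term i : (i < n)%N -> i.+1%:R * w / 2 - 1 <= nm (iter i.+1 T h).
  move=> iltn; rewrite (jordan_iter _ Tg Th) (addrC (_ *: h)).
  have := nmB (iota (i.+1%:R * (1 - mu) ^+ i * w) *: g) (iota ((1 - mu) ^+ i.+1) *: h).
  rewrite !nmZr ng nh !mulr1 !ger0_norm ?exprn_ge0 ?mulr_ge0 ?exprn_ge0//; try lra.
  have : (1 - mu) ^+ i.+1 <= 1 by rewrite exprn_ile1//; lra.
  have h2 : 2^-1 <= (1 - mu) ^+ i.
    have := bernoulli i; move: ((1 - mu) ^+ i) => p.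
    have : mu * i%:R <= mu * n%:R by rewrite ler_wpM2l// ler_nat ltnW.
    lra.
  have : i.+1%:R * w * 2^-1 <= i.+1%:R * w * (1 - mu) ^+ i.
    by rewrite ler_wpM2l// mulr_ge0.
  move: ((1 - mu) ^+ i) ((1 - mu) ^+ i.+1) => p q; lra.
rewrite ler_pdivlMl ?ltr0n//.
have : forall m, (m <= n)%N ->
    m%:R * (w * m.+1%:R / 4 - 1) <= \sum_(1 <= i < m.+1) nm (iter i T h).
  elim=> [|m IH] mn; first by rewrite mul0r big_nil.
  rewrite big_nat_recr//=.
  have := IH (ltnW mn); have := term m mn; rewrite -(natr1 m.+1) -(natr1 m) /=; lra.
by move=> /(_ n (leqnn n)).
Qed.

Lemma jordan_operator (e : nat -> X) (f : nat -> X -> K) :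
  (forall n, scalar (f n)) -> (forall n, bounded_by_nm (f n)) ->
  (forall n, nm (e n) = 1) -> (forall i j, f i (e j) = (i == j)%:R) ->
  exists (T : {linear X -> X}) (mu w : nat -> R) (n : nat -> nat),
    bounded_by_nm T /\ forall k,
    [/\ 0 < mu k <= 1 /\ 0 <= w k,
        T (e k.*2) = iota (1 - mu k) *: e k.*2,
        T (e k.*2.+1) = iota (1 - mu k) *: e k.*2.+1 + iota (w k) *: e k.*2,
        (k < n k)%N /\ mu k * (n k)%:R <= 2^-1 &
        4 * k.+1%:R <= w k * (n k).+1%:R].
Proof.
move=> fl /choice[B fB] ne fe.
have B0 n : 0 <= B n by have [] := fB n.
(* With [mu k <= w k], the three rank-one terms of [u k] have total norm at most [w k * D k], that
   is [2^-1 ^+ k]. *)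
pose D k := 2 * (B k.*2 + B k.*2.+1 + 1).
have D2 k : 2 <= D k by rewrite /D; have := B0 k.*2; have := B0 k.*2.+1; lra.
have h0 k : 0 < 2^-1 ^+ k :> R by rewrite exprn_gt0.
have h1 k : 2^-1 ^+ k <= 1 :> R by rewrite exprn_ile1 ?invf_le1 ?ler1n.
pose w k := 2^-1 ^+ k / D k.
have w0 k : 0 < w k by rewrite divr_gt0//; have := D2 k; lra.
have w1 k : w k <= 1.
  by rewrite ler_pdivrMr ?mul1r; have := D2 k; have := h1 k; lra.
(* The time [n k] is chosen after [w k], late enough for the mean to exceed [k]; then [mu k] is
   chosen so that decay up to that time costs at most a factor one half. *)
pose n k := (Num.truncn (4 * k.+1%:R / w k)).+1.
have nk k : 4 * k.+1%:R <= w k * (n k)%:R.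
  by rewrite [leRHS]mulrC -ler_pdivrMr//; exact: ltW (truncnS_gt _).
have kn k : (k < n k)%N.
  rewrite -(ler_nat R); apply: le_trans (_ : w k * (n k)%:R <= _).
    by apply: le_trans (nk k); rewrite ler_peMl// ler1n.
  by rewrite ler_piMl.
have n0 k : 0 < (n k)%:R :> R by rewrite ltr0n (leq_ltn_trans _ (kn k)).
pose mu k : R := (2 * (n k)%:R)^-1.
have mu0 k : 0 < mu k by rewrite invr_gt0 mulr_gt0.
have mun k : mu k * (n k)%:R = 2^-1.
  by rewrite /mu invfM -mulrA mulVf ?mulr1// gt_eqF.
have muw k : mu k <= w k.
  have : mu k * (n k)%:R <= w k * (n k)%:R.
    rewrite mun; apply: le_trans (nk k).
    have : 1 <= k.+1%:R :> R by rewrite ler1n.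
    lra.
  by rewrite ler_pM2r.
(* This is [T] minus the identity on block [k]; it kills all other basis vectors. *)
pose u k x := (iota (w k) * f k.*2.+1 x) *: e k.*2
  - ((iota (mu k) * f k.*2 x) *: e k.*2 + (iota (mu k) * f k.*2.+1 x) *: e k.*2.+1).
have ul k : linear (u k).
  move=> a x y; rewrite /u !fl.
  have E c i j : (iota c * (a * f i x + f i y)) *: e j =
      a *: ((iota c * f i x) *: e j) + (iota c * f i y) *: e j.
    by rewrite scalerA -scalerDl; congr (_ *: _); ring.
  by rewrite !E addrACA -scalerDr opprD addrACA -scalerBr.
have ub k x : nm (u k x) <= 2^-1 ^+ k * nm x.
  have E c i j : 0 < c -> nm ((iota c * f i x) *: e j) <= c * (B i * nm x).
    move=> c0; rewrite -scalerA nmZr gtr0_norm// ler_wpM2l ?(ltW c0)//.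
    by rewrite nmZ ne mulr1; have [_] := fB i.
  have E1 := E _ k.*2.+1 k.*2 (w0 k).
  have E2 := E _ k.*2 k.*2 (mu0 k).
  have E3 := E _ k.*2.+1 k.*2.+1 (mu0 k).
  have b0 i : 0 <= B i * nm x by rewrite mulr_ge0 ?nm_ge0.
  have m2 := ler_wpM2r (b0 k.*2) (muw k); have m3 := ler_wpM2r (b0 k.*2.+1) (muw k).
  apply: (le_trans (nmD _ _)); rewrite nmN.
  have := nmD ((iota (mu k) * f k.*2 x) *: e k.*2)
    ((iota (mu k) * f k.*2.+1 x) *: e k.*2.+1).
  have -> : 2^-1 ^+ k = w k * D k by rewrite divfK// gt_eqF//; have := D2 k; lra.
  have : 0 <= w k * (B k.*2 * nm x) by rewrite mulr_ge0// ltW.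
  have : 0 <= w k * nm x by rewrite mulr_ge0 ?nm_ge0// ltW.
  rewrite /D; lra.
have [S [Sb Su]] := operator_series ul ub.
pose T : {linear X -> X} := (idfun \+ S)%R.
have odd_even j k : (j.*2.+1 == k.*2) = false.
  by apply/eqP => /(congr1 odd); rewrite /= !odd_double.
have u0 k x : f k.*2 x = 0 -> f k.*2.+1 x = 0 -> u k x = 0.
  by rewrite /u => -> ->; rewrite !mulr0 !scale0r addr0 subr0.
exists T, mu, w, n; split.
  exists 3; split=> [//|x]; rewrite /T /=.
  by have := nmD x (S x); have := Sb x; lra.
move=> k; split.
- rewrite mu0 (ltW (w0 k)); split=> //=.
  by apply: le_trans (muw k) (w1 k).
- rewrite /T /= (Su _ k) => [|j jk].
    rewrite /u !fe eqxx odd_even.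
    by rewrite !mulr0 mulr1 !scale0r sub0r addr0 rmorphB rmorph1 scalerBl scale1r.
  by apply: u0; rewrite fe ?odd_even ?(inj_eq double_inj) ?(negPf jk).
- rewrite /T /= (Su _ k) => [|j jk].
    rewrite /u !fe eqxx (eq_sym k.*2) odd_even.
    rewrite !mulr0 !mulr1 !scale0r add0r rmorphB rmorph1 scalerBl scale1r.
    by rewrite addrCA addrC addrAC.
  by apply: u0; rewrite fe ?eqSS ?(inj_eq double_inj) ?(negPf jk)// eq_sym odd_even.
- by rewrite kn mun.
- by apply: le_trans (nk k) _; rewrite ler_wpM2l ?(ltW (w0 k))// ler_nat.
Qed.

End JordanBlocks.

(** * Dense sequences, and construction of the chaotic set over either field *)

Lemma separable_dense_seq (X : normedModType K) : separable X ->
  exists d : nat -> X, forall x r, 0 < r -> exists n, nm (d n - x) < r.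
Proof.
move=> [D [/countable_injP[c cinj] Ddense]].
(* Numbers that code no element of [D] are sent to 0. *)
have /choice[d dP] n : exists x, forall z, D z -> c z = n -> x = z.
  have [[z [Dz <-]]|nz] := pselect (exists z, D z /\ c z = n).
    by exists z => z' Dz' E; apply: cinj; rewrite ?inE.
  by exists 0 => z Dz E; exfalso; apply: nz; exists z.
exists d => x r r0.
have ir0 : 0 < iota r by rewrite -(rmorph0 iota) iota_lt.
have [] := Ddense (ball x (iota r)); [by exists x; exact: ballxx|exact: ball_open|].
move=> z [+ Dz]; rewrite -ball_normE /ball_ /= -[ltLHS]reK// iota_lt => xz.
by exists (c z); rewrite (dP _ _ Dz erefl) nmBC.
Qed.

Lemma dense_nm (X : normedModType K) (S : set X) :
  (forall x r, 0 < r -> exists2 z, S z & nm (z - x) < r) -> dense S.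
Proof.
move=> SP O [x Ox] Oo; have /nbhs_ballP[e /= e0 eO] : nbhs x O by exact: open_nbhs_nbhs.
have re0 : 0 < re e by rewrite -iota_lt rmorph0 reK// ltW.
have [z Sz zx] := SP x _ re0; exists z; split => //; apply: eO.
by rewrite -ball_normE /ball_ /= distrC -[ltLHS]reK// -[ltRHS](reK (ltW e0)) iota_lt.
Qed.

(** Separating functionals are taken as a hypothesis because they are obtained differently over the
    two scalar fields. *)
Lemma dense_mean_li_yorke (X : completeNormedModType K) :
  (forall v : X, v <> 0 -> exists phi : X -> K,
    [/\ scalar phi, bounded_by_nm phi & phi v = 1]) ->
  infinite_dimensional X -> separable X ->
  exists T : {linear X -> X}, bounded_operator T /\
    dense_mean_li_yorke_chaotic (fun x : X => nm x) T.
Proof.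
move=> separating Xinf Xsep.
have [d dP] := separable_dense_seq Xsep.
have [e [f [fl fB ne fe dE]]] := biorthogonal_system separating d Xinf.
have [T [mu [w [N [[M [M0 TM]] blocks]]]]] := jordan_operator fl fB ne fe.
exists T; split.
  by exists (iota M) => x; rewrite -[`|T x|]reK// -[`|x|]reK// -rmorphM iota_le.
have se2 k : summable_orbit T (e k.*2) /\ summable_orbit T (e k.*2.+1).
  have [[/andP[m0 m1] _] Tg Th _ _] := blocks k.
  have l0 : 0 <= 1 - mu k by lra.
  have l1 : 1 - mu k < 1 by lra.
  have sg : summable_orbit T (e k.*2).
    by apply: (summable_orbit_contraction l0 l1 _ (summable_orbit0 T)); rewrite addr0.
  by split => //; apply: (summable_orbit_contraction l0 l1 Th); exact: summable_orbitZ.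
have se n : summable_orbit T (e n).
  have [g h] := se2 n./2.
  by rewrite -(odd_double_half n); case: (odd n).
have sd n : summable_orbit T (d n).
  rewrite dE; elim/big_ind : _ => [|x y|i _]; first exact: summable_orbit0.
    exact: summable_orbitD.
  exact: summable_orbitZ.
have [||y yP] := irregular_vector TM.
- move=> x r r0; have [n nr] := dP x r r0.
  by exists (d n); split => //; exact: ltW.
(* The orbit mean of [e k.*2.+1] at time [N k] is at least [k], hence at least [3 / r]; scaling by
   [r] gives norm [r] and mean at least 3. *)
- move=> j r r0; pose k := maxn j (Num.truncn (3 / r)).+1.
  have [[/andP[m0 m1] w0] Tg Th [kN muN] wN] := blocks k.
  have [_ sh] := se2 k.
  exists (iota r *: e k.*2.+1), (N k); split.
  + exact: summable_orbitZ.
  + by rewrite nmZr ne mulr1 gtr0_norm.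
  + by rewrite (leq_trans (leq_maxl _ _) (ltnW kN)).
  rewrite orbit_meanZ gtr0_norm//.
  have N0 := leq_ltn_trans (leq0n _) kN.
  have mu01 : 0 <= mu k <= 1 by rewrite (ltW m0).
  have G := jordan_growth (ne _) (ne _) mu01 w0 N0 muN Tg Th.
  have kr : 3 / r <= k%:R.
    apply: le_trans (ltW (truncnS_gt _)) _; rewrite ler_nat; exact: leq_maxr.
  have : k%:R <= orbit_mean T (N k) (e k.*2.+1).
    by apply: le_trans G; move: wN; rewrite -(natr1 k); lra.
  move=> /(le_trans kr); rewrite ler_pdivrMr//; lra.
(* Adding a summable vector changes the means by a null sequence, so every [q + iota t *: y] with
   [t != 0] inherits the irregularity of [y]. Differences of points of the set have this form. *)
have irr q t : summable_orbit T q -> t != 0 ->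
    (forall r j, 0 < r -> exists2 n, (j <= n)%N & orbit_mean T n (q + iota t *: y) <= r) /\
    (forall j, exists2 n, (j <= n)%N & `|t| / 2 <= orbit_mean T n (q + iota t *: y)).
  move=> sq t0; have tp : 0 < `|t| by rewrite normr_gt0.
  split=> [r j r0|j].
    have r2 : 0 < r / 2 by lra.
    have [m mP] := summable_orbit_mean sq r2.
    pose k := maxn (maxn j m) (Num.truncn (2 * `|t| / r)).+1.
    have [[n kn Ln] _] := yP k; move: kn; rewrite !geq_max => /andP[/andP[jn mn] _].
    exists n => //; have := orbit_meanD T n q (iota t *: y); rewrite orbit_meanZ.
    have := mP n mn; suff : `|t| * orbit_mean T n y <= r / 2 by lra.
    have : 2 * `|t| / r <= k.+1%:R.
      by apply: le_trans (ltW (truncnS_gt _)) _; rewrite ler_nat leqW// leq_maxr.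
    have k0 : 0 < k.+1%:R :> R by [].
    have := ler_wpM2l (ltW tp) Ln; rewrite ler_pdivrMr// => h1 h2.
    apply: (le_trans h1); rewrite ler_pdivrMr//; lra.
  have t4 : 0 < `|t| / 2 by lra.
  have [m mP] := summable_orbit_mean sq t4.
  have [_ [n]] := yP (maxn j m); rewrite geq_max => /andP[jn mn] Ln.
  exists n => //; have := orbit_meanD T n (q + iota t *: y) (- q).
  rewrite addrAC subrr add0r orbit_meanN orbit_meanZ; have := mP n mn.
  have := ler_wpM2l (ltW tp) Ln; lra.
(* [p] takes each value [d n] at arguments [t] arbitrarily close to [0]. *)
pose p (t : R) := d (logn 2 (Num.truncn t^-1)).
pose s t := p t + iota t *: y.
have sB t t' : s t - s t' = (p t - p t') + iota (t - t') *: y.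
  by rewrite /s opprD addrACA rmorphB scalerBl.
have sp t t' : summable_orbit T (p t - p t').
  by apply: summable_orbitD; [exact: sd|apply: summable_orbitN; exact: sd].
(* If [s t = s t'] with [t != t'], some orbit mean of 0 would be positive. *)
have sinj : injective s.
  move=> t t' stt'; apply/eqP; rewrite -subr_eq0; apply/negPn/negP => tt'.
  have [_ /(_ 0%N)[n _]] := irr _ _ (sp t t') tt'; rewrite -sB stt' subrr.
  have -> : orbit_mean T n 0 = 0.
    by have := orbit_meanZ T n 0 0; rewrite rmorph0 scale0r normr0 mul0r.
  by apply/negP; rewrite -ltNge divr_gt0// normr_gt0.
exists (range s); split.
- apply: dense_nm => x r r0; have r2 : 0 < r / 2 by lra.
  have [n nr] := dP x _ r2.
  pose m := (Num.truncn (2 * nm y / r)).+1.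
  (* The 2-adic valuation of [t^-1] is [n], so [p t = d n], while the power of 3 makes [t] small. *)
  pose t : R := (2 ^ n * 3 ^ m)%:R^-1.
  exists (s t); first by exists t.
  have pt : p t = d n.
    rewrite /p /t invrK natrK lognM ?expn_gt0// !lognX.
    by rewrite logn_prime// !logn_prime// muln1 muln0 addn0.
  have t0 : 0 < t by rewrite invr_gt0 ltr0n muln_gt0 !expn_gt0.
  have ty : t * nm y < r / 2.
    rewrite mulrC ltr_pdivrMr ?ltr0n ?muln_gt0 ?expn_gt0//.
    have : 2 * nm y / r < (2 ^ n * 3 ^ m)%:R.
      apply: lt_le_trans (truncnS_gt _) _; rewrite ler_nat.
      apply: (leq_trans (ltnW (ltn_expl m (isT : (1 < 3)%N)))).
      by rewrite leq_pmull// expn_gt0.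
    by rewrite ltr_pdivrMr//; lra.
  have := nmD (d n - x) (iota t *: y).
  by rewrite nmZr gtr0_norm// /s pt addrAC; lra.
- rewrite (eq_countable (inj_card_eq _)); last by move=> ? ? _ _; exact: sinj.
  exact: uncountable_setT.
move=> _ _ [t _ <-] [t' _ <-] stt'.
have tt' : t - t' != 0 by rewrite subr_eq0; apply/eqP => tt'; apply: stt'; rewrite tt'.
have [low high] := irr _ _ (sp t t') tt'.
have E n : mean_orbit_dist (fun x : X => nm x) T (s t) (s t') n =
    orbit_mean T n (p t - p t' + iota (t - t') *: y).
  by rewrite -sB; exact: mean_orbit_distE.
split; under eq_fun do rewrite E.
  by apply: limn_einf_eq0 => // n; exact: orbit_mean_ge0.
by apply: limn_esup_gt0 high; rewrite divr_gt0// normr_gt0.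
Qed.

(** * Separating functionals over the real and the complex field *)

Lemma normalize_functional (X : normedModType K) (v : X) (f : X -> K) :
  scalar f -> bounded_by_nm f -> f v <> 0 ->
  exists phi : X -> K, [/\ scalar phi, bounded_by_nm phi & phi v = 1].
Proof.
move=> fl [B [B0 fB]] fv; exists (fun x => (f v)^-1 * f x); split.
- by move=> a x y; rewrite fl; ring.
- exists (nm (f v)^-1 * B); split=> [|x]; first by rewrite mulr_ge0// (nm_ge0 _).
  rewrite nmM -mulrA ler_wpM2l ?fB//.
  exact: (nm_ge0 _).
- by rewrite mulVf//; apply/eqP.
Qed.

Lemma norming_functional (X : normedModType K) (v : X) :
  exists f : X -> R, [/\ forall r x y, f (iota r *: x + y) = r * f x + f y,
    forall x, `|f x| <= nm x & f v = nm v].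
Proof.
have [f [fl fN fv]] := hahn_banach (@nmD X) (@nmZr X) v.
exists f; split => // x; rewrite ler_norml fN andbT.
have f0 : f 0 = 0 by have := fl (-1) 0 0; rewrite scaler0 addr0; lra.
have := fl (-1) x 0; rewrite f0 !addr0 rmorphN1 scaleN1r; have := fN (- x).
by rewrite nmN; lra.
Qed.

End RealValuedNorm.

Lemma real_functional (R : realType) (X : normedModType R) (v : X) : v <> 0 ->
  exists phi : X -> R, [/\ scalar phi, bounded_by_nm idfun phi & phi v = 1].
Proof.
move=> v0.
have le_id (x y : R) : (idfun x <= idfun y) = (x <= y) by [].
have idK (z : R) : 0 <= z -> idfun (idfun z) = z by [].
have [f [fl fN fv]] := norming_functional (iota := idfun) le_id idK v.
apply: (normalize_functional (iota := idfun) le_id idK (f := f)) => //.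
- by exists 1; split=> // x; rewrite mul1r; exact: fN.
- by rewrite fv /= => /normr0_eq0.
Qed.

Section ComplexScalars.
Context (R : realType).
Local Notation toC := (real_complex R).
Local Notation re := (@complex.Re R).
Local Notation i := (Complex (0 : R) 1).

Lemma toC_le (x y : R) : (toC x <= toC y) = (x <= y).
Proof. exact: lecR. Qed.

Lemma toC_Re (z : R[i]) : 0 <= z -> toC (re z) = z.
Proof. by move=> z0; rewrite RRe_real// ger0_real. Qed.

(* A real functional [phi] is the real part of the complex-linear functional
   [x |-> phi x - i phi (i x)]. *)
Lemma complex_functional (X : normedModType R[i]) (v : X) : v <> 0 ->
  exists phi : X -> R[i], [/\ scalar phi, bounded_by_nm re phi & phi v = 1].
Proof.
move=> v0; have [f [fl fN fv]] := norming_functional toC_le toC_Re v.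
have f0 : f 0 = 0 by have := fl (-1) 0 0; rewrite scaler0 addr0; lra.
have fD x y : f (x + y) = f x + f y.
  by have := fl 1 x y; rewrite rmorph1 scale1r mul1r.
have fZ r x : f (toC r *: x) = r * f x by have := fl r x 0; rewrite f0 !addr0.
apply: (normalize_functional toC_le toC_Re (f := fun x => Complex (f x) (- f (i *: x)))).
- move=> [a b] x y.
  have E z : Complex a b *: z = toC a *: z + toC b *: (i *: z).
    rewrite scalerA -scalerDl; congr (_ *: z); apply/eqP; rewrite eq_complex/=.
    by apply/andP; split; apply/eqP; ring.
  have iE z : i *: (Complex a b *: z) = toC a *: (i *: z) + toC (- b) *: z.
    rewrite !scalerA -scalerDl; congr (_ *: z); apply/eqP; rewrite eq_complex/=.
    by apply/andP; split; apply/eqP; ring.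
  rewrite scalerDr iE E !fD !fZ; apply/eqP; rewrite eq_complex/=.
  by apply/andP; split; apply/eqP; ring.
(* One factor of the square comes from [i] in front of the imaginary part, the other from the bound
   on [f (i *: x)]. *)
- exists (1 + re `|i| ^+ 2); split=> [|x].
    by rewrite addr_ge0 ?sqr_ge0.
  have -> : Complex (f x) (- f (i *: x)) = toC (f x) + i * toC (- f (i *: x)).
    by apply/eqP; rewrite eq_complex/=; apply/andP; split; apply/eqP; ring.
  apply: (le_trans (nmD toC_le toC_Re _ _)).
  rewrite (nmM toC_le toC_Re) !(nm_iota toC_le toC_Re).
  rewrite normrN mulrDl mul1r lerD ?fN//.
  rewrite expr2 -mulrA ler_wpM2l ?(nm_ge0 toC_le toC_Re i)//.
  by apply: (le_trans (fN _)); rewrite (nmZ toC_le toC_Re).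
(* The real part of the functional at [v] is the norm of [v]. *)
- move=> [] fv0 _; apply: v0; apply: (nm0_eq0 toC_Re).
  by rewrite -fv fv0.
Qed.

End ComplexScalars.

Theorem corollary1p3 (R : realType) :
  (forall X : completeNormedModType R,
     infinite_dimensional X -> separable X ->
     exists T : {linear X -> X},
       bounded_operator T /\ dense_mean_li_yorke_chaotic (@real_norm R X) T) /\
  (forall X : completeNormedModType R[i],
     infinite_dimensional X -> separable X ->
     exists T : {linear X -> X},
       bounded_operator T /\
       dense_mean_li_yorke_chaotic (@complex_norm R X) T).
Proof.
split=> X Xinf Xsep.
  exact: (dense_mean_li_yorke (iota := idfun) (re := idfun) _ _ (@real_functional R X)).
exact: (dense_mean_li_yorke (@toC_le R) (@toC_Re R) (@complex_functional R X)).
Qed.
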